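(* Let $f$ be an $S$-perfect structure over the cartesian product $G'\times G''$ of a regular graph $G'=(V',E')$ and a distance-regular graph $G''=(V'',E'')$. Let $F$ be some instance of $G'$ in $G'\times G''$, that is, the subgraph of $G'\times G''$ generated by the vertex subset $V'\times\{o\}$ for some $o\in V''$. Let $f_0$ be the sum of $f$ over (the vertices of) $F$. Then the weight distribution of $f$ with respect to $F$ is $$(f_0=f_0\Pi_0(S-dI),\ f_0\Pi_1(S-dI),\ \dots,\ f_0\Pi_{\mathrm{diam}(G'')}(S-dI))^{T},$$ where $d$ is the degree of $G'$, $I$ is the identity matrix, and $\Pi_0,\Pi_1,\dots$ are the $P$-polynomials of $G''$.
   Context: All graphs are finite and simple. For a graph $G=(V,E)$ with adjacency matrix $A$ and a real $\nu\times\nu$ matrix $S$, an $S$-perfect structure over $G$ is a real $|V|\times\nu$ matrix $f$ with $Af=fS$, regarded also as a function on $V$ with values the rows of $f$. The cartesian product $G'\times G''$ has vertex set $V'\times V''$; $(u',u'')$ and $(v',v'')$ are adjacent iff either $u'=v'$ and $\{u'',v''\}\in E''$, or $\{u',v'\}\in E'$ and $u''=v''$. A connected graph $G$ with adjacency matrix $A$ is distance-regular if for every $w=0,\dots,\mathrm{diam}(G)$ its distance-$w$ matrix $A_w$ ($(i,j)$ entry $1$ if the distance between $i$ and $j$ is $w$, else $0$) equals $\Pi_w(A)$ for some polynomial $\Pi_w$ of degree $w$; the $\Pi_w$ are called the $P$-polynomials of $G$. The weight distribution of $f$ with respect to a vertex set $C$ (here the vertex set of $F$) is $(h_0,\dots,h_{\rho})^T$,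 where $h_w$ is the sum of $f(v)$ over all vertices $v$ at distance $w$ from $C$ and $\rho$ is the maximum distance of a vertex from $C$. *)

(* Defs.v *)
From mathcomp Require Import all_boot all_order all_algebra.
From mathcomp Require Import reals.

Set Implicit Arguments.
Unset Strict Implicit.
Unset Printing Implicit Defensive.

Import GRing.Theory.
Local Open Scope ring_scope.

(* Finite simple graphs, with the usual convention that the vertex set is
   nonempty. *)
Record sgraph := SGraph {
  vert :> finType;
  adj : rel vert;
  adj_sym : symmetric adj;
  adj_irrefl : irreflexive adj;
  vert_gt0 : (0 < #|vert|)%N
}.

Section CartesianProduct.
Variables G1 G2 : sgraph.

Definition cart_adj : rel (vert G1 * vert G2) := fun u v =>
  ((u.1 == v.1) && adj u.2 v.2) || (adj u.1 v.1 && (u.2 == v.2)).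

Lemma cart_adj_sym : symmetric cart_adj.
Proof.
by move=> u v; rewrite /cart_adj (eq_sym v.1) (eq_sym v.2) !(adj_sym _ v.1)
  (adj_sym u.2).
Qed.

Lemma cart_adj_irrefl : irreflexive cart_adj.
Proof. by move=> u; rewrite /cart_adj !adj_irrefl andbF. Qed.

Lemma cart_gt0 : (0 < #|{: vert G1 * vert G2}|)%N.
Proof. by rewrite card_prod muln_gt0 !vert_gt0. Qed.

Definition cart_prod : sgraph :=
  SGraph cart_adj_sym cart_adj_irrefl cart_gt0.

Definition instance (o : G2) : {set cart_prod} := setX [set: G1] [set o].

End CartesianProduct.

Section Distance.
Variable G : sgraph.

Definition regular (d : nat) : Prop :=
  forall x : G, #|[set y : G | adj x y]| = d.

Definition connected : Prop := forall x y : G, connect (@adj G) x y.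

(* Least length of a walk from x to y.  Actual distances are < #|G|, and the
   value #|G| plays the role of infinity when no walk exists. *)
Definition dist (x y : G) : nat :=
  find (fun n => [exists p : n.-tuple G, path (@adj G) x p && (last x p == y)])
       (iota 0 #|vert G|).

Definition diam : nat := \max_(x : G) \max_(y : G) dist x y.

(* For C nonempty this is the minimum distance from x to an element of C. *)
Definition dist_set (x : G) (C : {set G}) : nat :=
  \big[minn/#|vert G|]_(c in C) dist x c.

Definition covering_radius (C : {set G}) : nat := \max_(x : G) dist_set x C.

End Distance.

Section Matrices.
Variable R : realType.

(* [horner_mx] is only available in dimension n.+1, whereas matrices below have
   dimension #|G|. *)
Definition mx_eval (n : nat) (p : {poly R}) (A : 'M[R]_n) : 'M[R]_n :=
  \sum_(i < size p) p`_i *: A ^+ i.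

Definition adj_mx (G : sgraph) : 'M[R]_#|vert G| :=
  \matrix_(i, j) (adj (enum_val i : G) (enum_val j))%:R.

Definition dist_mx (G : sgraph) (w : nat) : 'M[R]_#|vert G| :=
  \matrix_(i, j) (dist (enum_val i : G) (enum_val j) == w)%:R.

Definition P_polynomial (G : sgraph) (w : nat) (p : {poly R}) : Prop :=
  size p = w.+1 /\ dist_mx G w = mx_eval p (adj_mx G).

Definition distance_regular (G : sgraph) : Prop :=
  connected G /\
  forall w : nat, (w <= diam G)%N -> exists p, P_polynomial G w p.

Definition perfect_structure (G : sgraph) (nu : nat) (S : 'M[R]_nu)
    (f : 'M[R]_(#|vert G|, nu)) : Prop :=
  adj_mx G *m f = f *m S.

Definition value (G : sgraph) (nu : nat) (f : 'M[R]_(#|vert G|, nu)) (v : G)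
    : 'rV[R]_nu :=
  row (enum_rank v) f.

Definition sum_over (G : sgraph) (nu : nat) (f : 'M[R]_(#|vert G|, nu))
    (C : {set G}) : 'rV[R]_nu :=
  \sum_(v in C) value f v.

(* The list of rows h_0, ..., h_rho of the weight distribution. *)
Definition weight_distribution (G : sgraph) (nu : nat)
    (f : 'M[R]_(#|vert G|, nu)) (C : {set G}) : seq 'rV[R]_nu :=
  [seq \sum_(v : G | dist_set v C == w) value f v
     | w <- iota 0 (covering_radius C).+1].

End Matrices.

(* Main.v *)
Require Import Defs.
From mathcomp Require Import all_boot all_order all_algebra.
From mathcomp Require Import reals.

(** Why the theorem holds.  Summing [f] over each copy [V' x {y}] of [G'] gives a
    function [g] on [V''].  The neighbours of [(u, y)] are the [(u, z)] with [z]
    adjacent to [y] and the [(t, y)] with [t] adjacent to [u]; when the equations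
    [A f = f S] are summed over [u], the second kind contributes [d] times [g y]
    because [G'] is [d]-regular.  Hence [A'' g = g (S - d I)], i.e. [g] is an
    [(S - d I)]-perfect structure over [G''] ([layer_sums_perfect]).

    The relation [A'' g = g T] passes to polynomials, [p(A'') g = g p(T)], and for
    [p = Pi_w] the left-hand side is [A''_w g]: so the sum of [g] over the sphere
    of radius [w] around [o] is [g(o) Pi_w(T)] ([perfect_structure_dist]).  Since
    the distance from [(u, y)] to the copy [V' x {o}] is the distance from [y] to
    [o] ([dist_set_instance]), that sum is the [w]-th entry of the weight
    distribution of [f], and [g(o)] is [f_0].

    The range of [w] remains: the covering radius of the copy is the eccentricity
    of [o] in [G''], which must be the diameter ([eccentricity_diam]).  The
    matrices [A_w] are polynomials in [A] and add up to the all-one matrix [J], so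
    they commute with [J]; together with symmetry this makes all row sums of
    [A_w] equal, i.e. the size of a sphere of radius [w] does not depend on its
    centre.  For [w] equal to the diameter some sphere is nonempty, hence all
    are. *)

Set Implicit Arguments.
Unset Strict Implicit.

Import GRing.Theory.
Local Open Scope ring_scope.

(** * Distances and walks *)

Section Walks.
Variable G : sgraph.
Implicit Types x y : G.

Lemma dist_le_walk x y p :
  path (@adj G) x p -> last x p = y -> (dist x y <= size p)%N.
Proof.
move=> xp lp; have [lt_pG|le_Gp] := ltnP (size p) #|G|; last first.
  by rewrite (leq_trans (find_size _ _)) // size_iota.
rewrite leqNgt; apply/negP => /(before_find 0%N).
rewrite nth_iota // add0n => /negbT/existsPn/(_ (in_tuple p)).
by rewrite xp lp eqxx.
Qed.

(** [#|G|] is the value of [dist] on disconnected pairs, so being below it is what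
    guarantees that a walk realises the distance. *)
Lemma dist_walk x y :
  (dist x y < #|G|)%N ->
  exists p, [/\ path (@adj G) x p, last x p = y & size p = dist x y].
Proof.
move=> lt_dG; have := lt_dG; rewrite -[X in (_ < X)%N](size_iota 0) -has_find.
move=> /(nth_find 0%N); rewrite nth_iota // add0n => /existsP[p].
by case/andP=> xp /eqP lp; exists p; rewrite size_tuple.
Qed.

(** A walk without repeated vertices has fewer than [#|G|] steps. *)
Lemma dist_lt_card x y : connect (@adj G) x y -> (dist x y < #|G|)%N.
Proof.
case/connectP=> p xp ->{y}; case: (shortenP xp) => q xq uq _.
apply: leq_ltn_trans (dist_le_walk xq erefl) _.
by have := max_card (mem (x :: q)); rewrite (card_uniqP uq).
Qed.

Lemma dist_sym_le x y : connected G -> (dist y x <= dist x y)%N.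
Proof.
move=> conn; have [p [xp lp <-]] := dist_walk (dist_lt_card (conn x y)).
rewrite -(size_belast x p) -size_rev; apply: dist_le_walk.
  rewrite -lp rev_path; apply: etrans xp; apply: eq_path => u v.
  exact: adj_sym.
by case: p {xp} lp => //= z p _; rewrite rev_cons last_rcons.
Qed.

Lemma dist_sym x y : connected G -> dist x y = dist y x.
Proof. by move=> conn; apply/eqP; rewrite eqn_leq !dist_sym_le. Qed.

Lemma dist_eq0 x y : (dist x y == 0%N) = (x == y).
Proof.
apply/eqP/eqP=> [d0|->]; last first.
  by apply/eqP; rewrite -leqn0; apply: (@dist_le_walk _ _ [::]).
have [|p [_ lp]] := @dist_walk x y; first by rewrite d0 vert_gt0.
by rewrite d0 -lp => /size0nil ->.
Qed.

Lemma dist_le_diam x y : (dist x y <= diam G)%N.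
Proof.
apply: leq_trans (leq_bigmax x).
exact: (@leq_bigmax _ (fun y => dist x y)).
Qed.

Lemma diam_attained : exists x y : G, dist x y = diam G.
Proof.
have [x Dx] := eq_bigmax (fun x : G => \max_(y : G) dist x y)%N (vert_gt0 G).
have [y Dy] := eq_bigmax (fun y : G => dist x y) (vert_gt0 G).
by exists x, y; rewrite /diam Dx Dy.
Qed.

Lemma dist_set_le x (C : {set G}) c : c \in C -> (dist_set x C <= dist x c)%N.
Proof.
rewrite /dist_set => Cc; have := mem_index_enum c.
elim: (index_enum _) => //= a s IHs; rewrite inE big_cons.
case/predU1P=> [<-|/IHs]; first by rewrite Cc geq_minl.
by case: ifP => // _; apply: leq_trans; apply: geq_minr.
Qed.

(** The bound on [n] is there for the default value [#|G|] of the minimum. *)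
Lemma dist_set_ge x (C : {set G}) n :
  (n <= #|G|)%N -> {in C, forall c, n <= dist x c}%N -> (n <= dist_set x C)%N.
Proof.
move=> nG nC; rewrite /dist_set.
by elim/big_rec: _ => // c m /nC; rewrite leq_min => -> ->.
Qed.

End Walks.

(** * Distance to an instance of the first factor *)

Section ProductDistance.
Variables G1 G2 : sgraph.
Implicit Types (v : cart_prod G1 G2) (x y o : G2).

(** Dropping the steps that move inside the first factor leaves a walk in the
    second one. *)
Lemma walk_proj v p :
  path (@adj (cart_prod G1 G2)) v p ->
  exists q : seq G2,
    [/\ path (@adj G2) v.2 q, last v.2 q = (last v p).2 & (size q <= size p)%N].
Proof.
elim: p v => [|w p IHp] v /=; first by exists [::].
case/andP=> vw /IHp[q [wq lq le_qp]].
case/orP: vw => /andP[]; last first.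
  by move=> _ /eqP ->; exists q; rewrite ltnW.
by move=> _ vw; exists (w.2 :: q); rewrite /= vw.
Qed.

(** The first factor may be disconnected, in which case the distance between the
    two vertices can take its infinite value; the hypothesis excludes this. *)
Lemma dist_proj v w : (dist v w < #|cart_prod G1 G2|)%N ->
  (dist v.2 w.2 <= dist v w)%N.
Proof.
move=> /dist_walk[p [/walk_proj[q [vq lq le_qp]] lp <-]].
by apply: leq_trans (dist_le_walk vq _) le_qp; rewrite lq lp.
Qed.

Lemma dist_lift (u : G1) x y : connected G2 ->
  (dist ((u, x) : cart_prod G1 G2) ((u, y) : cart_prod G1 G2) <= dist x y)%N.
Proof.
move=> conn; have [p [xp lp <-]] := dist_walk (dist_lt_card (conn x y)).
rewrite -(size_map (pair u)); apply: dist_le_walk; last by rewrite last_map lp.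
rewrite path_map; apply: sub_path xp => a b ab.
by rewrite /= /cart_adj /= eqxx ab.
Qed.

(** A nearest point of the instance is the one with the same first coordinate:
    a walk in the second factor lifts to the fibre above that coordinate, and
    projecting a walk does not lengthen it. *)
Lemma dist_set_instance v o : connected G2 ->
  dist_set v (instance G1 o) = dist v.2 o.
Proof.
move=> conn; apply/eqP; rewrite eqn_leq; apply/andP; split.
  apply: leq_trans (_ : (dist v ((v.1, o) : cart_prod G1 G2) <= _)%N).
    by apply: dist_set_le; rewrite !inE /=.
  by case: v => u x; apply: dist_lift.
have le_dG : (dist v.2 o <= #|cart_prod G1 G2|)%N.
  apply: leq_trans (ltnW (dist_lt_card (conn _ _))) _.
  by rewrite card_prod leq_pmull // vert_gt0.
apply: dist_set_ge => // c; rewrite !inE /= => /eqP <-.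
(* Vertices of the instance that [v] cannot reach are at distance the order of
   the product, which still exceeds every distance of the second factor. *)
have [|le_Gd] := ltnP (dist v c) #|cart_prod G1 G2|; first exact: dist_proj.
apply: leq_trans le_Gd; apply: leq_trans (ltnW (dist_lt_card (conn _ _))) _.
by rewrite card_prod leq_pmull // vert_gt0.
Qed.

End ProductDistance.

(** * Perfect structures and distance matrices *)

Section Matrices.
Variable R : realType.

(** Used with [g] a perfect structure, and with [g] square to show that
    polynomials in commuting matrices commute. *)
Lemma mx_eval_intertwine m n (A : 'M[R]_m) (T : 'M[R]_n) (g : 'M[R]_(m, n)) p :
  A *m g = g *m T -> mx_eval p A *m g = g *m mx_eval p T.
Proof.
move=> AgT; rewrite mulmx_suml mulmx_sumr; apply: eq_bigr => i _.
rewrite -scalemxAl -scalemxAr; congr (_ *: _).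
elim: (nat_of_ord i) => [|k IHk].
  by rewrite !expr0 mul1mx mulmx1.
rewrite exprSr exprS -[A ^+ k * A]/(A ^+ k *m A) -[T * T ^+ k]/(T *m T ^+ k).
by rewrite -mulmxA AgT mulmxA IHk -mulmxA -[T ^+ k *m T]/(T ^+ k * T) -exprSr exprS.
Qed.

Variable G : sgraph.

(** Specialises to the adjacency matrix and to the distance matrices. *)
Lemma rel_mx_row (r : rel G) nu (f : 'M[R]_(#|G|, nu)) (x : G) :
  value ((\matrix_(i, j) (r (enum_val i) (enum_val j))%:R) *m f) x
    = \sum_(y | r x y) value f y.
Proof.
apply/rowP=> k; rewrite summxE !mxE.
rewrite (reindex enum_rank) /=; last exact: onW_bij (@enum_rank_bij _).
rewrite [RHS]big_mkcond; apply: eq_bigr => y _.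
by rewrite !mxE !enum_rankK; case: ifP; rewrite (mul1r, mul0r).
Qed.

Lemma perfect_structureP nu (S : 'M[R]_nu) (f : 'M[R]_(#|G|, nu)) :
  perfect_structure S f <->
  forall x : G, \sum_(y | adj x y) value f y = value f x *m S.
Proof.
split=> [fS x|fS].
  by rewrite -rel_mx_row -[X in value X]/(adj_mx R G *m f) fS /value row_mul.
apply/row_matrixP=> i; rewrite -(enum_valK i) [RHS]row_mul.
by rewrite -[row _ f]/(value f (enum_val i)) -fS -rel_mx_row.
Qed.

Lemma perfect_structure_dist nu (S : 'M[R]_nu) (f : 'M[R]_(#|G|, nu)) w p x :
  P_polynomial G w p -> perfect_structure S f ->
  \sum_(y | dist x y == w) value f y = value f x *m mx_eval p S.
Proof.
case=> _ Dp /(@mx_eval_intertwine _ _ _ _ _ p); rewrite -Dp => Dw.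
rewrite -(rel_mx_row (fun x y => dist x y == w)).
by rewrite -[X in value X]/(dist_mx R G w *m f) Dw /value row_mul.
Qed.

Lemma sum_dist_mx : \sum_(w < (diam G).+1) dist_mx R G w = const_mx 1.
Proof.
apply/matrixP=> i j; rewrite summxE !mxE.
have lt_d : (dist (enum_val i : G) (enum_val j) < (diam G).+1)%N.
  by rewrite ltnS dist_le_diam.
rewrite (bigD1 (Ordinal lt_d)) //= mxE eqxx big1 ?addr0 // => w.
by rewrite mxE eq_sym -val_eqE /= => /negbTE ->.
Qed.

(** Both matrices are polynomials in the adjacency matrix. *)
Lemma dist_mx_comm w1 w2 : distance_regular R G ->
  (w1 <= diam G)%N -> (w2 <= diam G)%N ->
  dist_mx R G w1 *m dist_mx R G w2 = dist_mx R G w2 *m dist_mx R G w1.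
Proof.
case=> _ DR /DR[p [_ ->]] /DR[q [_ ->]].
by apply/mx_eval_intertwine/esym/mx_eval_intertwine.
Qed.

(** [A_w] commutes with the all-one matrix [J], a sum of distance matrices.  The
    [(x, y)] entry of [A_w J] is the sum of row [x] of [A_w], and that of [J A_w]
    is the sum of column [y], which is also the sum of row [y] since distances
    are symmetric. *)
Lemma sphere_card_const w x y : distance_regular R G -> (w <= diam G)%N ->
  #|[set z : G | dist x z == w]| = #|[set z : G | dist y z == w]|.
Proof.
move=> DR le_w; have conn := DR.1.
have : dist_mx R G w *m const_mx 1 = const_mx 1 *m dist_mx R G w :> 'M_#|G|.
  rewrite -sum_dist_mx mulmx_suml mulmx_sumr; apply: eq_bigr => i _.
  by apply: dist_mx_comm => //; rewrite -ltnS.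
move/matrixP/(_ (enum_rank x) (enum_rank y)); rewrite !mxE => E.
apply/eqP; rewrite -(Num.Theory.eqr_nat R) -!sum1_card !natr_sum; apply/eqP.
have row_sum z : \sum_(t in [set t | dist z t == w]) 1
    = \sum_(j < #|G|) (dist z (enum_val j) == w)%:R :> R.
  rewrite [RHS](reindex enum_rank) /=; last exact: onW_bij (@enum_rank_bij _).
  rewrite big_mkcond; apply: eq_bigr => t _.
  by rewrite inE enum_rankK; case: ifP.
rewrite !row_sum; move: E; under eq_bigr do rewrite !mxE mulr1 enum_rankK.
move=> ->; apply: eq_bigr => j _.
by rewrite !mxE mul1r enum_rankK dist_sym.
Qed.

(** Some sphere whose radius is the diameter is nonempty, and spheres of equal
    radius have equal size. *)
Lemma eccentricity_diam o : distance_regular R G ->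
  (\max_(x : G) dist x o)%N = diam G.
Proof.
move=> DR; have conn := DR.1; apply/eqP; rewrite eqn_leq; apply/andP; split.
  by apply/bigmax_leqP => x _; apply: dist_le_diam.
have [x [y Dxy]] := diam_attained G.
have : (0 < #|[set z : G | dist o z == diam G]|)%N.
  rewrite (sphere_card_const o x) // card_gt0.
  by apply/set0Pn; exists y; rewrite inE Dxy.
rewrite card_gt0 => /set0Pn[z]; rewrite inE => /eqP <-.
rewrite dist_sym //; exact: (@leq_bigmax _ (fun x => dist x o)).
Qed.

End Matrices.

(** * Sums over the copies of the first factor *)

Section Layers.
Variables (R : realType) (G1 G2 : sgraph) (d nu : nat).
Variables (S : 'M[R]_nu) (f : 'M[R]_(#|cart_prod G1 G2|, nu)).

Definition layer_sums : 'M[R]_(#|G2|, nu) :=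
  \matrix_(i < #|G2|) \sum_(u : G1) value f ((u, enum_val i) : cart_prod G1 G2).

Lemma layer_sumsE (y : G2) :
  value layer_sums y = \sum_(u : G1) value f ((u, y) : cart_prod G1 G2).
Proof. by rewrite /value rowK enum_rankK. Qed.

Lemma sum_cart (P : pred G1) (Q : pred G2) (D : pred (cart_prod G1 G2))
    (F : cart_prod G1 G2 -> 'rV[R]_nu) :
  (forall v, D v = P v.1 && Q v.2) ->
  \sum_(v | D v) F v = \sum_(u | P u) \sum_(x | Q x) F (u, x).
Proof.
by move=> DE; rewrite pair_big; apply: eq_big => [v|[u x]] //; apply: DE.
Qed.

Lemma sum_over_instance (o : G2) : sum_over f (instance G1 o) = value layer_sums o.
Proof.
rewrite layer_sumsE /sum_over.
rewrite (@sum_cart predT (pred1 o)) => [|v]; last first.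
  by case: v => u x; rewrite in_setX !inE.
by apply: eq_bigr => u _; rewrite big_pred1_eq.
Qed.

(** Each [t] is counted once for each of its [d] neighbours [u]. *)
Lemma sum_neighbours_regular (g : G1 -> 'rV[R]_nu) : regular G1 d ->
  \sum_u \sum_(t | adj u t) g t = (\sum_t g t) *+ d.
Proof.
move=> reg; rewrite (exchange_big_dep predT) //= -sumrMnl.
apply: eq_bigr => t _; rewrite sumr_const; congr (_ *+ _).
by rewrite -(reg t) cardsE; apply: eq_card => u; exact: adj_sym.
Qed.

(** The edges inside the copies of [G1] are accounted for by the correction
    [- d] to the matrix [S]. *)
Lemma layer_sums_perfect : regular G1 d -> perfect_structure S f ->
  perfect_structure (S - d%:R%:M) layer_sums.
Proof.
move=> reg /perfect_structureP fS; apply/perfect_structureP => y.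
rewrite mulmxBr mul_mx_scalar scaler_nat layer_sumsE.
rewrite -(sum_neighbours_regular _ reg) mulmx_suml -sumrB.
under eq_bigr do rewrite layer_sumsE.
rewrite exchange_big /=; apply: eq_bigr => u _; rewrite -fS.
(* Neighbours of [(u, y)] are split by first coordinate: those above [u] are the
   steps in [G2], the others are the steps in [G1]. *)
rewrite (bigID (fun v : cart_prod G1 G2 => v.1 == u)) /=.
apply/eqP; rewrite eq_sym subr_eq; apply/eqP; congr (_ + _).
  rewrite (@sum_cart (pred1 u) (adj y)) ?big_pred1_eq // => v.
  rewrite /= /cart_adj /= eq_sym.
  by case: eqP => [->|_]; rewrite ?adj_irrefl ?orbF ?andbT ?andbF.
rewrite (@sum_cart (adj u) (pred1 y)) => [|v].
  by apply: eq_bigr => t _; rewrite big_pred1_eq.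
rewrite /= /cart_adj /= eq_sym (eq_sym y).
by case: eqP => [->|_]; rewrite ?adj_irrefl ?andbF ?andbT.
Qed.

Lemma weight_instance (o : G2) w : connected G2 ->
  \sum_(v | dist_set v (instance G1 o) == w) value f v
    = \sum_(y | dist o y == w) value layer_sums y.
Proof.
move=> conn; under [RHS]eq_bigr do rewrite layer_sumsE.
rewrite exchange_big /=.
apply: (@sum_cart predT (fun y => dist o y == w)) => v.
by rewrite dist_set_instance // dist_sym.
Qed.

Lemma covering_radius_instance (o : G2) : distance_regular R G2 ->
  covering_radius (instance G1 o) = diam G2.
Proof.
move=> DR; rewrite -(eccentricity_diam o DR) /covering_radius.
have [u _] : exists u : G1, u \in G1 by apply/card_gt0P/vert_gt0.
under eq_bigr do rewrite (dist_set_instance _ _ DR.1).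
apply/eqP; rewrite eqn_leq; apply/andP; split; apply/bigmax_leqP => v _.
  exact: (@leq_bigmax _ (fun x => dist x o)).
exact: (@leq_bigmax _ (fun v : G1 * G2 => dist v.2 o) (u, v)).
Qed.

End Layers.

(** * The weight distribution with respect to an instance *)

Theorem theorem6 (R : realType) (G1 G2 : sgraph) (d nu : nat)
    (S : 'M[R]_nu) (f : 'M[R]_(#|vert (cart_prod G1 G2)|, nu))
    (Pi : nat -> {poly R}) (o : G2) :
  regular G1 d ->
  distance_regular R G2 ->
  (forall w : nat, (w <= diam G2)%N -> P_polynomial G2 w (Pi w)) ->
  perfect_structure S f ->
  let F : {set cart_prod G1 G2} := instance G1 o in
  let f0 : 'rV[R]_nu := sum_over f F in
  f0 = f0 *m mx_eval (Pi 0%N) (S - d%:R%:M) /\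
  weight_distribution f F =
    [seq f0 *m mx_eval (Pi w) (S - d%:R%:M) | w <- iota 0 (diam G2).+1].
Proof.
move=> reg DR PiP fS F f0.
have layerS := layer_sums_perfect reg fS.
have sphere w : (w <= diam G2)%N ->
    \sum_(y | dist o y == w) value (layer_sums f) y
      = f0 *m mx_eval (Pi w) (S - d%:R%:M).
  move=> le_w; rewrite /f0 /F sum_over_instance.
  exact: perfect_structure_dist (PiP w le_w) layerS.
split.
  rewrite -sphere // (eq_bigl (pred1 o)) ?big_pred1_eq.
    exact: sum_over_instance.
  by move=> y; rewrite dist_eq0 eq_sym.
rewrite /weight_distribution /F (covering_radius_instance G1 o DR).
apply/eq_in_map => w; rewrite mem_iota ltnS => /andP[_ le_w].
by rewrite (weight_instance _ _ _ DR.1) sphere.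
Qed.
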